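(* Let $n \ge 4$ be an integer. In the Maker-Breaker Hamiltonian Path game $\mathcal{HP}_n$ on $E(K_n)$, Maker as first player has a winning strategy if and only if $n \geq 5$; and likewise Maker as second player has a winning strategy if and only if $n \geq 5$.
   Context: A positional game is a hypergraph $(X,\mathcal{F})$, where $X$ is a finite set (the board) and $\mathcal{F}\subseteq 2^X$ is a family of winning sets. In the Maker-Breaker game on $(X,\mathcal{F})$, two players, Maker and Breaker, alternately claim previously unclaimed elements of $X$, one element per move, until all elements are claimed. Maker wins if he claims all elements of some winning set; Breaker wins if he claims at least one element of every winning set. ''Maker as first player'' means that Maker makes the first move; ''Maker as second player'' means that Breaker makes the first move. A player ''wins'' the game if he has a winning strategy, i.e. a strategy that guarantees his win against every play of the opponent. In the Hamiltonian Path game $\mathcal{HP}_n$, the board is $X = E(K_n)$, the edge set of the complete graph on $n$ vertices, and the winning sets are the edge sets of all Hamiltonian paths of $K_n$ (with arbitrary endpoints). *)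

(* Defs.v *)
From mathcomp Require Import all_boot.
Set Implicit Arguments.
Unset Strict Implicit.
Unset Printing Implicit Defensive.

(* A positional game (X, F): the board is the whole finite type X, and the
   family of winning sets is F : {set {set X}}.

   A play lists the claimed elements, oldest first; it is legal iff it is
   duplicate-free, and complete when every element of X occurs in it. *)
Definition complete_play (X : finType) (p : seq X) : Prop :=
  uniq p /\ (forall x, x \in p).

Inductive seat := First | Second.

(* Moves are numbered from 0. *)
Definition moves_at (s : seat) (i : nat) : bool :=
  match s with First => ~~ odd i | Second => odd i end.

Definition claimed (X : finType) (s : seat) (p : seq X) : {set X} :=
  [set x in p | moves_at s (index x p)].

Definition maker_wins_play (X : finType) (F : {set {set X}}) (s : seat)
    (p : seq X) : Prop :=
  exists2 A, A \in F & A \subset claimed s p.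

Definition strategy (X : finType) := seq X -> X.

(* Without legality, a strategy proposing already claimed elements would have
   no complete play following it, and would win vacuously. *)
Definition legal_strategy (X : finType) (s : seat) (sigma : strategy X) : Prop :=
  forall h : seq X, uniq h -> size h < #|X| -> moves_at s (size h) ->
    sigma h \notin h.

Definition follows (X : finType) (s : seat) (sigma : strategy X) (p : seq X)
    : Prop :=
  forall h x t, p = h ++ x :: t -> moves_at s (size h) -> x = sigma h.

Definition maker_winning_strategy (X : finType) (F : {set {set X}}) (s : seat)
    (sigma : strategy X) : Prop :=
  legal_strategy s sigma /\
  (forall p, complete_play p -> follows s sigma p -> maker_wins_play F s p).

Definition maker_wins (X : finType) (F : {set {set X}}) (s : seat) : Prop :=
  exists sigma : strategy X, maker_winning_strategy F s sigma.

Definition K_edge (n : nat) : finType := {e : {set 'I_n} | #|e| == 2}.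

Definition path_edges (n : nat) (p : seq 'I_n) : {set K_edge n} :=
  [set e : K_edge n |
    has (fun xy => val e == [set xy.1; xy.2]) (zip p (behead p))].

(* A duplicate-free n-tuple of vertices of K_n visits every vertex once. *)
Definition HP (n : nat) : {set {set K_edge n}} :=
  [set path_edges t | t : n.-tuple 'I_n & uniq t].

(* Main.v *)
(* For n = 4, the first and the last edge of a Hamiltonian path are complementary
   as sets of vertices, so Breaker wins by always claiming the complement of
   Maker's last edge.

   For n >= 5, Maker wins even if Breaker starts.  The cases n = 5 and n = 6 are
   settled by evaluating a game search.  Let then W be a set of m vertices, m even,
   on which Maker can build a Hamiltonian path P.
   - m + 1 vertices: by a pairing strategy Maker also joins the new vertex v to at
     least m/2 vertices of W.  Then v is adjacent to an end of P or to two
     consecutive vertices of P, so that it can be inserted.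
   - m + 2 vertices: when Breaker claims ab, Maker claims ac for some other vertex
     c, and W consists of the vertices other than a and c.  He plays separately on
     W and on the stars of a and c, and thus joins a to at least m/2 - 1 and c to
     at least m/2 vertices of W; by counting, the segment ac can be inserted
     into P in one of the two directions. *)

Require Import Defs.
From mathcomp Require Import all_boot.
From mathcomp Require Import zify.
Set Implicit Arguments.
Unset Strict Implicit.
Unset Printing Implicit Defensive.

(** * Game values *)

Section Value.
Variable X : finType.
Implicit Types (P Q R : pred {set X}) (M U : {set X}).

(** The fuel [k] bounds the rounds to come. The test [U != set0] keeps a full board without [P] from
    being a vacuous win. *)
Fixpoint mbwin_rec P k M U : bool :=
  P M || if k is k'.+1 then
    (U != set0) && [forall x in U, exists y in U :\ x,
      mbwin_rec P k' (y |: M) (U :\ x :\ y)]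
  else false.

(* Breaker is to move, Maker owns M, and U is the set of free elements. *)
Definition mbwin P M U : bool := mbwin_rec P #|U| M U.

Definition upclosed P := forall M M', M \subset M' -> P M -> P M'.

(** A round uses up two free elements, so [#|U|] rounds suffice and further fuel changes nothing. *)
Lemma mbwin_rec_fuel P k M U : #|U| <= k -> mbwin_rec P k M U = mbwin P M U.
Proof.
rewrite /mbwin; have [l] := ubnP #|U|; elim: l U k M => // l IH U k M Ul Uk.
have [->|U0] := eqVneq U set0; first by rewrite cards0; case: k Uk => //= k _; rewrite eqxx.
have Upos : 0 < #|U| by rewrite card_gt0.
case: k Uk => [|k] Uk; first by lia.
case E: #|U| => [|u]; first by lia.
rewrite /= U0 /=; congr (_ || _).
apply: eq_forallb => x; case xU: (x \in U) => //=.
apply: eq_existsb => y; case yU: (y \in U :\ x) => //=.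
have c1 := cardsD1 x U; have c2 := cardsD1 y (U :\ x).
rewrite xU yU in c1 c2.
by rewrite IH ?[RHS]IH //; lia.
Qed.

Lemma mbwinP P M U :
  reflect (P M \/ U != set0 /\ forall x, x \in U ->
             exists2 y, y \in U :\ x & mbwin P (y |: M) (U :\ x :\ y))
          (mbwin P M U).
Proof.
have -> : mbwin P M U = P M || (U != set0) &&
    [forall x in U, exists y in U :\ x, mbwin P (y |: M) (U :\ x :\ y)].
  rewrite -(@mbwin_rec_fuel P #|U|.+1) //=; congr (_ || (_ && _)).
  apply: eq_forallb => x; congr (_ ==> _); apply: eq_existsb => y.
  congr (_ && _); apply: mbwin_rec_fuel.
  by apply: subset_leq_card; rewrite setDDl subsetDl.
apply: (iffP orP) => -[PM|]; try by left.
  case/andP=> U0 /forall_inP H; right; split=> // x /H /exists_inP[y yU W].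
  by exists y.
case=> U0 H; right; rewrite U0; apply/forall_inP => x /H[y yU W].
by apply/exists_inP; exists y.
Qed.

Lemma mbwin_done P M U : P M -> mbwin P M U.
Proof. by move=> PM; apply/mbwinP; left. Qed.

Lemma mbwin_set0 P M : mbwin P M set0 = P M.
Proof. by rewrite /mbwin cards0 /= orbF. Qed.

Lemma upclosed1 P x M : upclosed P -> P M -> P (x |: M).
Proof. by move=> upP; apply: upP; apply: subsetU1. Qed.

Lemma setD1_ltn (x : X) U : x \in U -> #|U :\ x| < #|U|.
Proof. by move=> xU; rewrite [ltnRHS](cardsD1 x) xU. Qed.

Lemma setD2_ltn (x y : X) U : x \in U -> #|U :\ x :\ y| < #|U|.
Proof.
move=> xU; apply: leq_ltn_trans (setD1_ltn xU).
by apply: subset_leq_card; rewrite subsetDl.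
Qed.

Lemma mbwin_sub P M M' U : upclosed P -> M \subset M' -> mbwin P M U -> mbwin P M' U.
Proof.
move=> upP; have [k] := ubnP #|U|; elim: k M M' U => // k IH M M' U Uk MM'.
case/mbwinP=> [PM|[U0 H]]; first by apply: mbwin_done; apply: upP PM.
apply/mbwinP; right; split=> // x xU; have [y yU W] := H x xU; exists y => //.
apply: IH W; last exact: setUS.
by apply: leq_trans (setD2_ltn y xU) _; lia.
Qed.

Lemma mbwin_impl P Q M U : (forall N, P N -> Q N) -> mbwin P M U -> mbwin Q M U.
Proof.
move=> PQ; have [k] := ubnP #|U|; elim: k M U => // k IH M U Uk.
case/mbwinP=> [/PQ QM|[U0 H]]; first exact: mbwin_done.
apply/mbwinP; right; split=> // x xU; have [y yU W] := H x xU; exists y => //.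
by apply: IH W; apply: leq_trans (setD2_ltn y xU) _; lia.
Qed.

(** Maker follows his old strategy; when it asks for the extra element, he takes any other free one,
    which becomes the new extra element. This covers an opening move by Maker and spare moves in
    sums of games. *)
Lemma mbwin_extra P M U y : upclosed P -> y \in U -> mbwin P M U ->
  mbwin P (y |: M) (U :\ y).
Proof.
move=> upP; have [k] := ubnP #|U|; elim: k M U y => // k IH M U y Uk yU.
case/mbwinP=> [PM|[U0 H]]; first by apply: mbwin_done; apply: upclosed1.
have [PyM|nPyM] := boolP (P (y |: M)); first exact: mbwin_done.
apply/mbwinP; right; split=> [|x].
  by have [z zU _] := H y yU; apply/set0Pn; exists z.
rewrite !inE => /andP[xy xU]; have [z] := H x xU.
have lt w : #|U :\ x :\ w| < k by apply: leq_trans (setD2_ltn w xU) _; lia.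
have [->{z} zU W|zy] := eqVneq z y.
  (* If nothing else is free, the old strategy ends with exactly [y |: M], which then satisfies
     [P]. *)
  have [E|/set0Pn[w wU]] := eqVneq (U :\ x :\ y) set0.
    by move: W; rewrite E mbwin_set0 (negbTE nPyM).
  have -> : U :\ y :\ x = U :\ x :\ y by rewrite !setDDl setUC.
  by exists w => //; apply: IH.
rewrite !inE => /andP[zx zU] W; exists z; first by rewrite !inE zx zy zU.
have := IH _ _ y (lt z) _ W; rewrite !inE yU eq_sym zy eq_sym xy => /(_ isT).
by rewrite setUCA; congr mbwin; apply/setP=> w; rewrite !inE; do !case: eqP => //.
Qed.

(* Maker answers each Breaker move in the component where it was played; when
   that component has no free element left, his move elsewhere can only help. *)
Lemma mbwin_disjoint P Q R M U1 U2 : upclosed P -> upclosed Q ->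
  (forall N, P N -> Q N -> R N) -> [disjoint U1 & U2] ->
  mbwin P M U1 -> mbwin Q M U2 -> mbwin R M (U1 :|: U2).
Proof.
have [k] := ubnP (#|U1| + #|U2|); elim: k P Q M U1 U2 => // k IH.
(* Breaker's move [x] lies in [U1]; the other case exchanges the two games. *)
have half P Q M (U1 U2 : {set X}) x : #|U1| + #|U2| < k.+1 -> upclosed P -> upclosed Q ->
    (forall N, P N -> Q N -> R N) -> [disjoint U1 & U2] ->
    mbwin P M U1 -> mbwin Q M U2 -> ~~ R M -> x \in U1 ->
    exists2 y, y \in (U1 :|: U2) :\ x & mbwin R (y |: M) ((U1 :|: U2) :\ x :\ y).
  move=> Uk upP upQ PQR dis WP WQ nR xU1.
  have xU2 : x \notin U2 by rewrite (disjointFr dis).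
  have c1 := cardsD1 x U1; rewrite xU1 in c1.
  have in1 y : y \in U1 :\ x -> mbwin P (y |: M) (U1 :\ x :\ y) ->
      exists2 y, y \in (U1 :|: U2) :\ x & mbwin R (y |: M) ((U1 :|: U2) :\ x :\ y).
    move=> yU W; exists y; first by move: yU; rewrite !inE => /andP[-> ->].
    have yU1 : y \in U1 by move: yU; rewrite !inE => /andP[].
    have yU2 : y \notin U2 by rewrite (disjointFr dis).
    have -> : (U1 :|: U2) :\ x :\ y = (U1 :\ x :\ y) :|: U2.
      apply/setP=> z; rewrite !inE; case: eqP => [->|_] /=; first by rewrite (negbTE yU2).
      by case: eqP => [->|_] //=; rewrite (negbTE xU2).
    apply: (IH P Q) => //; last by apply: mbwin_sub WQ; rewrite ?subsetU1.
    - by have := setD1_ltn yU; lia.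
    - by apply: disjointWl dis; rewrite setDDl subsetDl.
  case/mbwinP: (WP) => [PM|[_ /(_ x xU1)[y]]]; last exact: in1.
  (* Here [P M] already holds, so any reply will do: in [U1] if possible, else as an extra move in
     [U2]. *)
  have [E|/set0Pn[y yU]] := eqVneq (U1 :\ x) set0; last first.
    by apply: in1 yU _; apply: mbwin_done; apply: upclosed1.
  have [E2|/set0Pn[y yU]] := eqVneq U2 set0.
    by move: WQ; rewrite E2 mbwin_set0 => QM; rewrite PQR in nR.
  have yx : y != x by apply: contraNneq xU2 => <-.
  exists y; first by rewrite !inE yx yU orbT.
  have yU1 : y \notin U1 by rewrite (disjointFl dis).
  have -> : (U1 :|: U2) :\ x :\ y = (U1 :\ x) :|: (U2 :\ y).
    apply/setP=> z; rewrite !inE; case: eqP => [->|_] /=; first by rewrite (negbTE yU1) andbF.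
    by case: eqP => [->|_] //=; rewrite (negbTE xU2).
  apply: (IH P Q) => //; last exact: mbwin_extra.
  - by have := setD1_ltn yU; lia.
  - by apply: disjointWl (subsetDl _ _) (disjointWr (subsetDl _ _) dis).
  - by apply: mbwin_done; apply: upclosed1.
move=> P Q M U1 U2 Uk upP upQ PQR dis WP WQ.
have [RM|nR] := boolP (R M); first exact: mbwin_done.
apply/mbwinP; right; split.
  apply: contraNneq nR => /eqP; rewrite setU_eq0 => /andP[/eqP E1 /eqP E2].
  by move: WP WQ; rewrite E1 E2 !mbwin_set0; apply: PQR.
move=> x; rewrite inE => /orP[xU|xU]; first exact: (half P Q).
rewrite setUC; apply: (half Q P) => //; first by rewrite addnC.
  by move=> N QN PN; apply: PQR.
by rewrite disjoint_sym.
Qed.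

Lemma mbwin_widen P M U U' : upclosed P -> U \subset U' -> mbwin P M U -> mbwin P M U'.
Proof.
move=> upP UU' W; rewrite -(setID U' U) (setIidPr UU').
(* The additional elements form a second game whose goal is always met. *)
apply: (@mbwin_disjoint _ predT) W _ => //; last exact: mbwin_done.
by rewrite disjoint_sym disjoints_subset setDE subsetIr.
Qed.

(** Any free element is a good reply: alternate moves give Maker half of [U], rounded down, when
    Breaker starts. *)
Lemma mbwin_card (S : {set X}) d M U : U \subset S -> [disjoint M & U] ->
  d <= #|M :&: S| + #|U|./2 -> mbwin [pred N | d <= #|N :&: S|] M U.
Proof.
have [k] := ubnP #|U|; elim: k M U => // k IH M U Uk US dis dle.
have [dM|dM] := leqP d #|M :&: S|; first exact: mbwin_done.
have U2 : 1 < #|U| by lia.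
apply/mbwinP; right; split; first by rewrite -card_gt0; lia.
move=> x xU; have cx := cardsD1 x U; rewrite xU in cx.
have /set0Pn[y yU] : U :\ x != set0 by rewrite -card_gt0; lia.
exists y => //; have cy := cardsD1 y (U :\ x); rewrite yU in cy.
have yU' : y \in U by move: yU; rewrite inE => /andP[].
have sub : U :\ x :\ y \subset U by rewrite setDDl subsetDl.
apply: IH; first by lia.
- exact: subset_trans US.
- rewrite -setI_eq0; apply/eqP/setP=> z; rewrite !inE.
  have := disjointFr dis (x := z); case: eqP => //= _.
  by case: (z \in M) => // /(_ isT) ->; rewrite andbF.
have -> : (y |: M) :&: S = y |: (M :&: S).
  apply/setP=> z; rewrite !inE; case: eqP => [->|] //=.
  by rewrite (subsetP US).
rewrite cardsU1 inE (disjointFl dis) //=; lia.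
Qed.

End Value.

(** Passes to a copy of the board: [HP] is played on a subtype, the graph arguments on sets of
    vertices. *)
Lemma mbwin_inj (X Y : finType) (f : X -> Y) (P : pred {set Y}) (M U : {set X}) :
  injective f -> mbwin P (f @: M) (f @: U) -> mbwin (fun N => P (f @: N)) M U.
Proof.
move=> f_inj; have [k] := ubnP #|U|; elim: k M U => // k IH M U Uk.
case/mbwinP=> [PM|[U0 H]]; first exact: mbwin_done.
apply/mbwinP; right; split; first by rewrite -(imset_eq0 f).
move=> x xU; have [|y] := H (f x); first exact: imset_f.
rewrite !inE => /andP[yx /imsetP[z zU yz]]; rewrite {y}yz in yx *.
have D (V : {set X}) w : (f @: V) :\ f w = f @: (V :\ w).
  apply/setP=> t; apply/idP/imsetP.
    rewrite !inE => /andP[tw /imsetP[s sV ts]]; exists s => //.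
    by rewrite !inE sV andbT; apply: contraNneq tw => <-; rewrite ts.
  by case=> s; rewrite !inE => /andP[sw sV] ->; rewrite imset_f // (inj_eq f_inj) sw.
rewrite !D -imsetU1 => W; exists z; first by rewrite !inE zU andbT -(inj_eq f_inj).
by apply: IH W; apply: leq_trans (setD2_ltn z xU) _; lia.
Qed.

(** * From game values to strategies *)

Section Play.
Variable X : finType.
Implicit Types (h p t : seq X) (s : seat).

Lemma moves_atS s i : moves_at s i.+1 = ~~ moves_at s i.
Proof. by case: s => /=; rewrite ?negbK. Qed.

Lemma claimed_cat s h t : claimed s h \subset claimed s (h ++ t).
Proof.
by apply/subsetP=> x; rewrite !inE mem_cat index_cat => /andP[-> ->].
Qed.

Lemma claimed_rcons s h x : x \notin h ->
  claimed s (rcons h x) = if moves_at s (size h) then x |: claimed s h else claimed s h.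
Proof.
move=> xh; apply/setP=> z; rewrite -cats1 !inE mem_cat index_cat !inE.
have [zh|zh] := boolP (z \in h).
  have zx : z != x by apply: contraNneq xh => <-.
  by rewrite (fun_if (fun A : {set X} => z \in A)) !inE zh (negbTE zx) if_same.
rewrite (fun_if (fun A : {set X} => z \in A)) !inE (negbTE zh) orbF.
by case: eqP => [->|_] /=; rewrite ?eqxx ?addn0; case: ifP.
Qed.

Lemma fresh h : size h < #|X| -> exists x, x \notin h.
Proof.
move=> lt; suff /card_gt0P[x xh] : 0 < #|[predC h]| by exists x.
by rewrite -(ltn_add2l #|h|) addn0 cardC; apply: leq_ltn_trans (card_size h) lt.
Qed.

(** Maker keeps the position won with Breaker to move. This serves both seats, since an opening move
    by Maker is an extra element. *)
Lemma mbwin_maker (F : {set {set X}}) s (x0 : X) :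
  mbwin (fun M => [exists A in F, A \subset M]) set0 setT -> maker_wins F s.
Proof.
set P := (P in mbwin P); move=> W.
have upP : upclosed P.
  move=> M M' sub /exists_inP[A AF AM]; apply/exists_inP; exists A => //.
  exact: subset_trans sub.
pose good h y := (y \notin h) && mbwin P (y |: claimed s h) (~: [set z in y :: h]).
(* Lacking a good move, the strategy takes any free element, so as to be legal after every history;
   [x0] is its value on full boards. *)
pose sigma h := odflt (odflt x0 [pick y | y \notin h]) [pick y | good h y].
have sigmaP h y : good h y -> good h (sigma h).
  by move=> gy; rewrite /sigma; case: (pickP (good h)) => [//|/(_ y)]; rewrite gy.
exists sigma; split=> [h uh lt _|p [up fp] fol].
  rewrite /sigma; case: (pickP (good h)) => [y /andP[]|_] //=.
  have [x xh] := fresh lt.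
  by case: pickP => [//|/(_ x)]; rewrite xh.
(* The induction runs over the positions of [p] with Breaker to move. *)
suff key h t : p = h ++ t -> ~~ moves_at s (size h) ->
    mbwin P (claimed s h) (~: [set z in h]) -> P (claimed s p).
  suff : P (claimed s p) by case/exists_inP=> A AF AM; exists A.
  have E0 : claimed s [::] = set0 :> {set X} by apply/setP=> x; rewrite !inE.
  case: s @good @sigma sigmaP fol key E0 => good sigma sigmaP fol key E0; last first.
    by apply: (key [::] p) => //; rewrite E0 (_ : ~: _ = setT) //; apply/setP=> x; rewrite !inE.
  case: p up fp fol key => [|x p] up fp fol key; first by have := fp x0.
  have xE : x = sigma [::] by apply: (fol [::] x p).
  (* Some opening is good, hence so is the one chosen by [sigma]. *)
  have gx0 : good [::] x0.
    by rewrite /good E0 /=; have := mbwin_extra upP (in_setT x0) W; congr mbwin;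
       apply/setP=> y; rewrite !inE ?andbT.
  apply: (key [:: x] p) => //.
  have /andP[_] := sigmaP _ _ gx0; rewrite -xE.
  by rewrite -[x |: _](@claimed_rcons First [::] x isT).
have [k] := ubnP (size t); elim: k h t => // k IH h t lt pE turn.
case/mbwinP=> [PM|[/set0Pn[x]]].
  by apply: upP PM; rewrite pE claimed_cat.
rewrite !inE => xh H.
have t0 : t != [::] by apply: contraNneq xh => t0; have := fp x; rewrite pE t0 cats0.
case: t t0 lt pE => // {xh}x t _ lt pE.
have xh : x \notin h by move: up; rewrite pE cat_uniq /= => /and3P[_ /norP[]].
have [|y yU Wy] := H x; first by rewrite !inE.
move: yU; rewrite !inE => /andP[yx yh].
have t0 : t != [::].
  apply: contraNneq yh => t0; have := fp y; rewrite pE t0 mem_cat mem_seq1.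
  by rewrite (negbTE yx) orbF.
case: t t0 lt pE => // z t _ lt pE.
have zE : z = sigma (rcons h x).
  apply: (fol (rcons h x) z t); first by rewrite cat_rcons.
  by rewrite size_rcons moves_atS.
have cE : claimed s (rcons h x) = claimed s h by rewrite claimed_rcons // (negbTE turn).
have gy : good (rcons h x) y.
  rewrite /good mem_rcons inE negb_or yx yh cE /=; move: Wy; congr mbwin.
  by apply/setP=> w; rewrite !inE mem_rcons inE !negb_or.
have /andP[zh Wz] := sigmaP _ _ gy; rewrite -zE in zh Wz.
apply: (IH (rcons (rcons h x) z) t).
- by move: lt => /=; lia.
- by rewrite !cat_rcons.
- by rewrite !size_rcons !moves_atS negbK.
rewrite claimed_rcons // size_rcons moves_atS turn.
by move: Wz; congr mbwin; apply/setP=> w; rewrite !inE [in RHS]mem_rcons inE.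
Qed.

(* Breaker answers x by c x, and plays anything when c x is already his. *)
Lemma pairing_breaker (F : {set {set X}}) s (c : X -> X) :
  involutive c -> (forall x, c x != x) ->
  (forall A, A \in F -> exists2 x, x \in A & c x \in A) -> ~ maker_wins F s.
Proof.
move=> cK c_neq FA [sigma [legal win]].
(* The invariant of Breaker's play: Maker never owns a pair. One complete play against [sigma] that
   keeps it is a contradiction. *)
pose split h := forall x, x \in claimed s h -> c x \in h /\ c x \notin claimed s h.
suff [p [[up fp] fol sp]] : exists p, [/\ complete_play p, follows s sigma p & split p].
  have [A AF /subsetP AM] := win p (conj up fp) fol.
  have [x xA cxA] := FA A AF.
  by have [_ /negP[]] := sp x (AM x xA); apply: AM.
have fol_rcons h x : follows s sigma h -> (moves_at s (size h) -> x = sigma h) ->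
    follows s sigma (rcons h x).
  move=> fh xE g y t; case/lastP: t => [|t z].
    by rewrite cats1 => /rcons_inj[<- <-].
  by rewrite -rcons_cons -rcons_cat => /rcons_inj[/fh].
suff key h : uniq h -> follows s sigma h -> split h ->
    exists p, [/\ complete_play p, follows s sigma p & split p].
  by apply: (key [::]) => // [[]|x]; rewrite ?inE.
have [k] := ubnP (#|X| - size h); elim: k h => // k IH h lt uh fh sh.
have [full|part] := leqP #|X| (size h).
  exists h; split=> //; split=> // x.
  apply: contraTT full => xh; rewrite -ltnNge.
  have /card_uniqP/= <- : uniq (x :: h) by rewrite /= xh.
  exact: max_card.
have [turn|turn] := boolP (moves_at s (size h)); last first.
  have [x xh] := fresh part.
  apply: (IH (rcons h x)); rewrite ?size_rcons ?rcons_uniq ?xh //; first by lia.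
    by apply: fol_rcons => //; rewrite (negbTE turn).
  move=> z; rewrite claimed_rcons // (negbTE turn) mem_rcons inE => /sh[-> ->].
  by rewrite orbT.
set y := sigma h; have yh : y \notin h by apply: legal.
have c1 : claimed s (rcons h y) = y |: claimed s h by rewrite claimed_rcons // turn.
have u1 : uniq (rcons h y) by rewrite rcons_uniq yh.
have f1 : follows s sigma (rcons h y) by apply: fol_rcons.
have ncy : c y \notin claimed s h by apply: contra yh => /sh[]; rewrite cK.
have nc z : z \in claimed s h -> c z != y.
  by move=> zh; apply: contraNneq yh => <-; case: (sh z zh).
have [cyh|cyh] := boolP (c y \in h).
  apply: (IH (rcons h y)) => //; first by rewrite size_rcons; lia.
  move=> z; rewrite c1 !in_setU1 mem_rcons inE => /orP[/eqP ->|zh].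
    by rewrite (negbTE (c_neq y)) cyh.
  by have [a b] := sh z zh; rewrite (negbTE (nc z zh)) a.
have cyh1 : c y \notin rcons h y by rewrite mem_rcons inE negb_or c_neq.
apply: (IH (rcons (rcons h y) (c y))); rewrite ?rcons_uniq ?cyh1 ?yh //.
- by rewrite !size_rcons; lia.
- by apply: fol_rcons => //; rewrite size_rcons moves_atS turn.
move=> z; rewrite claimed_rcons // size_rcons moves_atS turn /= c1 !in_setU1 mem_rcons in_cons mem_rcons in_cons.
case/orP=> [/eqP ->|zh]; first by rewrite eqxx (negbTE (c_neq y)).
by have [a b] := sh z zh; rewrite (negbTE (nc z zh)) a !orbT; split.
Qed.

End Play.

(** * A verified game solver *)

Section Solver.
Variable T : eqType.
Implicit Types (fam : seq (seq T)) (free A : seq T).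

Definition shortest fam : seq T :=
  foldr (fun A B => if size A <= size B then A else B) (head [::] fam) (behead fam).

Definition without (x : T) := filter (predC1 x).

(** The first disjunct cuts the search once a single element completes a winning set. Since not all
    replies are tried, only the answer [true] is conclusive. *)
Definition has_reply (rec : seq (seq T) -> seq T -> bool) fam free x :=
  let fam' := [seq A <- fam | x \notin A] in
  let free' := without x free in
  has (fun A => (size A == 1) && all (mem free') A) fam' ||
  has (fun y => (y \in free') && rec (map (without y) fam') (without y free'))
      (shortest fam').

(* fam lists, for some of the winning sets that Breaker has not yet hit, the
   elements that Maker still misses; Maker only tries elements of a shortest one. *)
Fixpoint solve k fam free : bool :=
  has (@nilp _) fam || if k is k'.+1 then
    ~~ nilp free && all (has_reply (solve k') fam free) free
  else false.

Variables (X : finType) (P : pred {set X}) (f : T -> X).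

(** Quantifying over all [M'] above [M] makes the property persist as Maker's set grows. *)
Definition wins_by (M : {set X}) A := forall M' : {set X},
  M \subset M' -> (forall e, e \in A -> f e \in M') -> P M'.

(** Stated for any sound [rec], to serve both the recursion of [solve] and a search started after
    Breaker's opening. *)
Lemma has_reply_mbwin (rec : seq (seq T) -> seq T -> bool) fam free (M U : {set X}) x :
  (forall fam free (M U : {set X}), {in free &, injective f} ->
     U =i map f free -> (forall A, A \in fam -> wins_by M A) ->
     rec fam free -> mbwin P M U) ->
  {in free &, injective f} -> U =i map f free ->
  (forall A, A \in fam -> wins_by M A) -> x \in free ->
  has_reply rec fam free x ->
  exists2 y, y \in U :\ f x & mbwin P (y |: M) (U :\ f x :\ y).
Proof.
move=> recP f_inj UE famP xfree.
have inU y : y \in without x free -> f y \in U :\ f x.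
  rewrite mem_filter /= => /andP[yx yfree].
  rewrite !inE UE map_f // andbT; apply: contra yx => /eqP E.
  by apply/eqP/f_inj.
case/orP=> /hasP[].
  move=> [|y [|//]] //=; rewrite mem_filter => /andP[_ /famP win].
  rewrite andbT => yfree; exists (f y); first exact: inU.
  apply: mbwin_done; apply: win; first exact: subsetU1.
  by move=> e; rewrite inE => /eqP ->; apply: setU11.
move=> y _ /andP[yfree /recP H]; exists (f y); first exact: inU.
move: yfree; rewrite mem_filter => /andP[/= yx yfree].
apply: H.
- by move=> a b; rewrite !mem_filter => /and3P[_ _ aF] /and3P[_ _ bF]; apply: f_inj.
- move=> z; rewrite !inE UE; apply/and3P/mapP.
    case=> zy zx /mapP[w wF zw]; exists w => //.
    by rewrite !mem_filter wF /= andbT; apply/andP; split;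
       [apply: contraNneq zy | apply: contraNneq zx] => <-; rewrite zw.
  case=> w; rewrite !mem_filter /= => /and3P[wy wx wF] ->; split; last exact: map_f.
    by apply: contra wy => /eqP/f_inj ->.
  by apply: contra wx => /eqP/f_inj ->.
move=> B /mapP[A]; rewrite mem_filter => /andP[_ AF] ->{B} M' sub AM'.
apply: (famP A) => //; first exact: subset_trans (subsetU1 _ _) sub.
move=> e eA; have [->|ey] := eqVneq e y; first by rewrite (subsetP sub) // setU11.
by apply: AM'; rewrite mem_filter /= ey.
Qed.

Lemma solve_mbwin k fam free (M U : {set X}) :
  {in free &, injective f} -> U =i map f free ->
  (forall A, A \in fam -> wins_by M A) -> solve k fam free -> mbwin P M U.
Proof.
elim: k fam free M U => [|k IH] fam free M U f_inj UE famP /= /orP[/hasP[A AF A0]|] //.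
- by apply: mbwin_done; apply: (famP A) => //; case: A A0 {AF}.
- by apply: mbwin_done; apply: (famP A) => //; case: A A0 {AF}.
case/andP=> free0 /allP H; apply/mbwinP; right; split.
  case: free UE {H f_inj} free0 => // x free UE _; apply/set0Pn; exists (f x).
  by rewrite UE mem_head.
move=> x; rewrite UE => /mapP[e eF ->].
exact: has_reply_mbwin (H e eF).
Qed.

End Solver.

(** * Inserting a segment into a path *)

Section Insert.
Variables (V : eqType) (e : rel V).
Hypothesis e_sym : symmetric e.
Implicit Types (p g : seq V).

(* If neither g nor its reversal can be inserted, the extremal case is that both
   ends of g are adjacent to exactly every second vertex, hence the parities. *)
Lemma path_insert h g x p : path e h g ->
  path e x p ->
  size p < count (e h) p + count (e (last h g)) p
           + (if e x h then if e x (last h g) then 2 - odd (size p) else 1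
              else if e x (last h g) then 1 else odd (size p)) ->
  exists2 q, perm_eq q (h :: g ++ p) & path e x q.
Proof.
have lastE : last (last h g) (rev (belast h g)) = h.
  by case: (g) => [|z g'] //=; rewrite ?rev_cons ?last_rcons.
set l := last h g in lastE *; move=> hg; elim: p x => [|y p IH] x.
  move=> _ /=; have [xh _|xh] := boolP (e x h).
    by exists (h :: g); rewrite ?cats0 //= xh.
  case: ifP => // xl _; exists (rev (h :: g)).
    by rewrite cats0 perm_sym -perm_rev.
  rewrite lastI rev_rcons /= xl /= -/l rev_path.
  by rewrite (eq_path (e' := e)) // => a b; rewrite e_sym.
rewrite [path e x _]/= => /andP[xy yp].
have [/andP[xh ly] _|n1] := boolP (e x h && e l y).
  by exists (h :: g ++ y :: p) => //=; rewrite xh cat_path hg /= -/l ly.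
have [/andP[xl hy] _|n2] := boolP (e x l && e h y).
  exists (rev (h :: g) ++ y :: p).
    by rewrite -cat_cons perm_cat2r perm_rev.
  rewrite lastI rev_rcons /= xl /= cat_path -/l rev_path.
  rewrite (eq_path (e' := e)); last by move=> a b; rewrite e_sym.
  rewrite hg /= yp andbT.
  by rewrite lastE.
(* Neither direction fits between [x] and [y]: at most one of [e x h], [e l y] holds, and at most
   one of [e x l], [e h y]. This carries the inequality over to the path from [y]. *)
move=> lt; have [|q pq yq] := IH y yp; last first.
  exists (y :: q); last by rewrite /= xy.
  rewrite perm_sym; apply: perm_trans (permEl (perm_catCA (h :: g) [:: y] p)) _.
  by rewrite /= perm_cons perm_sym.
move: lt n1 n2; rewrite /= (e_sym y h) (e_sym y l).
by case: (e x h); case: (e x l); case: (e h y); case: (e l y) => //=; case: (odd (size p)); lia.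
Qed.

Lemma sorted_insert h g p : path e h g -> sorted e p -> ~~ odd (size p) ->
  size p <= count (e h) p + count (e (last h g)) p + 1 ->
  exists2 q, perm_eq q (h :: g ++ p) & sorted e q.
Proof.
case: p => [|x p] hg; first by exists (h :: g); rewrite ?cats0.
move=> /= xp; rewrite negbK => odd_p lt.
have [xh|xh] := boolP (e (last h g) x).
  by exists (h :: g ++ x :: p) => //; rewrite /= cat_path hg /= xh.
have [xl|xl] := boolP (e h x).
  exists (rev (h :: g) ++ x :: p).
    by rewrite -cat_cons perm_cat2r perm_rev.
  rewrite lastI rev_rcons /= cat_path rev_path.
  rewrite (eq_path (e' := e)); last by move=> a b; rewrite e_sym.
  rewrite hg /= xp andbT; suff -> : last (last h g) (rev (belast h g)) = h by [].
  by case: (g) => [|z g'] //=; rewrite ?rev_cons ?last_rcons.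
have [|q pq xq] := @path_insert h g x p hg xp.
  by move: lt; rewrite ![e x _]e_sym (negbTE xh) (negbTE xl) odd_p; lia.
exists (x :: q) => //.
rewrite perm_sym; apply: perm_trans (permEl (perm_catCA (h :: g) [:: x] p)) _.
  by rewrite /= perm_cons perm_sym.
Qed.

End Insert.

(** * The Hamiltonian path game *)

Definition pair_seqs n : seq (nat * nat) := [seq (i, j) | j <- iota 0 n, i <- iota 0 j].

Definition npath_edges (p : seq nat) : seq (nat * nat) :=
  [seq (minn xy.1 xy.2, maxn xy.1 xy.2) | xy <- zip p (behead p)].

(** A path and its reverse have the same edges; the condition on the ends keeps one of them. *)
Definition npaths n : seq (seq (nat * nat)) :=
  [seq npath_edges p | p <- permutations (iota 0 n) & head 0 p < last 0 p].

(* Not vm_compute: call-by-value evaluates both arguments of ||, so that the search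
   would never stop at the first winning reply. *)
Lemma solve5 : has_reply (solve 4) (npaths 5) (pair_seqs 5) (0, 1).
Proof. by lazy. Qed.

(** After the first round 13 of the 15 edges are free, hence fuel 6; five vertices leave 8 edges,
    hence fuel 4 there. *)
Lemma solve6 : has_reply (solve 6) (npaths 6) (pair_seqs 6) (0, 1).
Proof. by lazy. Qed.

Section Graph.
Variable V : finType.
Implicit Types (W : {set V}) (M : {set {set V}}) (u v w : V).

Definition edges W : {set {set V}} := [set e : {set V} | (e \subset W) && (#|e| == 2)].

Definition star v W : {set {set V}} := [set [set v; w] | w in W].

Definition adj M : rel V := fun u v => [set u; v] \in M.

Definition hpath W M : bool :=
  [exists t : #|W|.-tuple V, [&& uniq t, [set x in t] == W & sorted (adj M) t]].

Lemma hpathP W M :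
  reflect (exists p, [/\ uniq p, p =i W & sorted (adj M) p]) (hpath W M).
Proof.
apply: (iffP existsP) => [[t /and3P[ut /eqP tW st]]|[p [up pW sp]]].
  by exists t; split=> // x; move/setP/(_ x): tW; rewrite inE.
have sz : size p == #|W| by rewrite -(card_uniqP up) (eq_card pW).
exists (Tuple sz); rewrite /= up sp andbT /=.
by apply/eqP/setP=> x; rewrite inE pW.
Qed.

Lemma adj_sym M : symmetric (adj M).
Proof. by move=> u v; rewrite /adj setUC. Qed.

Lemma adj_sub M M' : M \subset M' -> subrel (adj M) (adj M').
Proof. by move=> /subsetP sub u v; apply: sub. Qed.

Lemma hpath_upclosed W : upclosed (hpath W).
Proof.
move=> M M' sub /hpathP[p [up pW sp]]; apply/hpathP; exists p; split=> //.
exact: sub_sorted (adj_sub sub) _ sp.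
Qed.

Lemma card_star_upclosed d v W : upclosed [pred M | d <= #|M :&: star v W|].
Proof.
move=> M M' sub /= dM; apply: leq_trans dM _.
exact/subset_leq_card/setSI.
Qed.

Lemma edgesP W e :
  reflect (exists u v, [/\ u != v, u \in W, v \in W & e = [set u; v]]) (e \in edges W).
Proof.
rewrite inE; apply: (iffP andP) => [[eW /cards2P[u [v [uv eE]]]]|[u [v [uv uW vW ->]]]].
  exists u, v; split=> //; apply: (subsetP eW); rewrite eE !inE eqxx ?orbT //.
by rewrite cards2 uv; split=> //; apply/subsetP=> w; rewrite !inE => /orP[] /eqP ->.
Qed.

Lemma set2_inj u : injective (fun v => [set u; v]).
Proof.
move=> v w E; have := set22 u v; have := set22 u w; rewrite -{1}E {2}E !inE.
by move=> /orP[/eqP->|/eqP->] // /orP[/eqP->|/eqP->].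
Qed.

Lemma card_star v W : #|star v W| = #|W|.
Proof. exact/card_imset/set2_inj. Qed.

Lemma edges_sub W W' : W \subset W' -> edges W \subset edges W'.
Proof.
move=> WW'; apply/subsetP=> e; rewrite !inE => /andP[eW ->].
by rewrite (subset_trans eW WW').
Qed.

Lemma star_sub v W W' : v \in W' -> v \notin W -> W \subset W' -> star v W \subset edges W'.
Proof.
move=> vW' vW /subsetP WW'; apply/subsetP=> _ /imsetP[w wW ->].
apply/edgesP; exists v, w; split=> //; last exact: WW'.
by apply: contraNneq vW => ->.
Qed.

Lemma star_edges_disjoint v W W' : v \notin W -> [disjoint edges W & star v W'].
Proof.
move=> vW; rewrite -setI_eq0; apply/eqP/setP=> e; rewrite !inE.
apply/negP=> /andP[/andP[/subsetP eW _] /imsetP[w _ eE]].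
by move: vW; rewrite eW // eE set21.
Qed.

Lemma count_adj v W M p : uniq p -> p =i W -> #|M :&: star v W| <= count (adj M v) p.
Proof.
move=> up pW.
have -> : count (adj M v) p = #|[set w in W | adj M v w]|.
  rewrite -size_filter -(card_uniqP (filter_uniq _ up)).
  by apply: eq_card => w; rewrite mem_filter inE pW andbC.
rewrite -(card_imset _ (@set2_inj v)).
apply/subset_leq_card/subsetP=> e /setIP[eM /imsetP[w wW eE]].
by apply/imsetP; exists w; rewrite // inE wW /adj -eE.
Qed.

(** * Adding one or two vertices *)

(** The new vertex is a segment whose two ends coincide, so Maker's edges at [v] count twice in
    [sorted_insert]. *)
Lemma mbwin_hpathS v W : v \in W -> ~~ odd #|W :\ v| ->
  mbwin (hpath (W :\ v)) set0 (edges (W :\ v)) -> mbwin (hpath W) set0 (edges W).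
Proof.
move=> vW even win; have vW' : v \notin W :\ v by rewrite !inE eqxx.
apply: (@mbwin_widen _ _ _ (edges (W :\ v) :|: star v (W :\ v))).
- exact: hpath_upclosed.
- by rewrite subUset edges_sub ?star_sub ?subsetDl.
apply: (@mbwin_disjoint _ _ [pred M | #|W :\ v|./2 <= #|M :&: star v (W :\ v)|] _
          _ _ _ _ _ _ _ win).
- exact: hpath_upclosed.
- exact: (@card_star_upclosed #|W :\ v|./2).
- move=> M /hpathP[p [up pW sp]] /= deg.
  have sz : size p = #|W :\ v| by rewrite -(card_uniqP up) (eq_card pW).
  have := leq_trans deg (count_adj _ _ up pW) => cnt.
  have [||q pq sq] := @sorted_insert _ _ (adj_sym M) v [::] p isT sp.
  + by rewrite sz.
  + by rewrite sz /=; have := odd_double_half #|W :\ v|; lia.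
  apply/hpathP; exists q; split=> //.
    by rewrite (perm_uniq pq) /= up andbT pW !inE eqxx.
  by move=> x; rewrite (perm_mem pq) !inE pW !inE; case: eqVneq => // ->.
- exact: star_edges_disjoint.
apply: mbwin_card => //; first by rewrite -setI_eq0 set0I.
by rewrite card_star; lia.
Qed.

Lemma mbwin_hpathSS W : 3 < #|W| -> ~~ odd #|W| ->
  (forall W', #|W'| = #|W| - 2 -> mbwin (hpath W') set0 (edges W')) ->
  mbwin (hpath W) set0 (edges W).
Proof.
move=> W3 even win; apply/mbwinP; right; split.
  have /card_gt1P[a [b [aW bW ab]]] : 1 < #|W| by lia.
  by apply/set0Pn; exists [set a; b]; apply/edgesP; exists a, b.
move=> _ /edgesP[a [b [ab aW bW ->]]].
have cW := cardsD1 a W; rewrite aW in cW.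
have cW2 := cardsD1 b (W :\ a); rewrite !inE eq_sym ab bW in cW2.
have /set0Pn[c] : W :\ a :\ b != set0 by rewrite -card_gt0; lia.
rewrite !inE => /and3P[cb ca cW'].
exists [set a; c].
  rewrite !inE; apply/and3P; split.
  - by rewrite (inj_eq (@set2_inj a)).
  - by apply/subsetP=> w; rewrite !inE => /orP[] /eqP ->.
  - by rewrite cards2 [a == c]eq_sym ca.
set W' := W :\ a :\ c.
have cW3 := cardsD1 c (W :\ a); rewrite !inE ca cW' /= in cW3.
have sW' : #|W'| = #|W| - 2 by rewrite /W'; lia.
have even' : ~~ odd #|W'| by rewrite sW'; lia.
(* Without [ab] the star of [a] has [#|W'| - 1] edges; half of that, rounded down, is [da]. Then
   [da + dc + 1] is exactly [#|W'|], as [sorted_insert] requires. *)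
pose dc := #|W'|./2; pose da := #|W'|./2.-1.
have dW' : #|W'| <= da + dc + 1 by rewrite /da /dc; lia.
have daW' m : #|W'| = true + m -> da <= m./2 by rewrite /da => ->; rewrite add1n; lia.
have aW' : a \notin W' by rewrite !inE eqxx andbF.
have cW'' : c \notin W' by rewrite !inE eqxx.
have bW' : b \in W' by rewrite !inE eq_sym cb eq_sym ab.
have aNe e : e \in edges W' :|: star c W' -> a \notin e.
  rewrite inE => /orP[/edgesP[u [v [_ uW vW ->]]]|/imsetP[w wW ->]]; rewrite !inE negb_or.
    by apply/andP; split; apply: contraNneq aW' => ->.
  by rewrite eq_sym ca /=; apply: contraNneq aW' => ->.
(* With [ab] and [ac] taken, play continues on three disjoint boards. *)
apply: (@mbwin_widen _ _ _ (edges W' :|: star c W' :|: (star a W' :\ [set a; b]))).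
- exact: hpath_upclosed.
- have sub : edges W' :|: star c W' :|: star a W' \subset edges W.
    have W'W : W' \subset W by rewrite /W' setDDl subsetDl.
    by rewrite !subUset edges_sub ?star_sub.
  apply/subsetP=> e; rewrite in_setU => eU; rewrite !in_setD1.
  have -> /= : e \in edges W.
    apply: (subsetP sub); rewrite in_setU; move: eU.
    by case/orP=> [->|/setD1P[_ ->]]; rewrite ?orbT.
  rewrite andbT; case/orP: eU => [/aNe ae|/setD1P[-> /imsetP[w wW ->]]].
    by apply/andP; split; apply: contraNneq ae => ->; rewrite set21.
  by rewrite andbT (inj_eq (@set2_inj a)); apply: contraNneq cW'' => <-.
rewrite setU0; set M0 := [set [set a; c]].
pose P1 : pred {set {set V}} := fun N => ([set a; c] \in N) && hpath W' N.
have win1 : mbwin P1 M0 (edges W').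
  rewrite -[edges W']set0U.
  (* Owning [ac] is a goal met on the empty board; it is carried along so that the segment is
     available at the end. *)
  apply: (@mbwin_disjoint _ (fun N => [set a; c] \in N) (hpath W')).
  - by move=> N N' /subsetP sub /=; apply: sub.
  - exact: hpath_upclosed.
  - by move=> N acN hN; apply/andP.
  - by rewrite -setI_eq0 set0I.
  - by apply: mbwin_done; rewrite /= set11.
  - by apply: mbwin_sub (win _ sW'); [apply: hpath_upclosed | apply: sub0set].
have up1 : upclosed P1.
  move=> N N' sub /andP[acN hN]; apply/andP; split; first exact: (subsetP sub).
  exact: hpath_upclosed hN.
pose Pc : pred {set {set V}} := fun N => dc <= #|N :&: star c W'|.
pose Pa : pred {set {set V}} := fun N => da <= #|N :&: star a W'|.
have win2 : mbwin (predI P1 Pc) M0 (edges W' :|: star c W').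
  apply: (mbwin_disjoint (Q := Pc) up1 _ _ _ win1).
  - exact: (@card_star_upclosed dc).
  - by move=> N hN dN; apply/andP.
  - exact: star_edges_disjoint.
  apply: mbwin_card; first exact: subxx.
    rewrite disjoint_sym disjoints_subset; apply/subsetP=> _ /imsetP[w wW ->].
    rewrite in_setC in_set1; apply: contraNneq aW' => E.
    by have := set21 a c; rewrite -E in_set2 eq_sym (negbTE ca) => /eqP->.
  by rewrite card_star leq_addl.
have win3 : mbwin Pa M0 (star a W' :\ [set a; b]).
  apply: mbwin_card; first exact: subsetDl.
    rewrite disjoint_sym disjoints_subset; apply/subsetP=> _ /setD1P[_ /imsetP[w wW ->]].
    by rewrite !inE (inj_eq (@set2_inj _)); apply: contraNneq cW'' => <-.
  have := cardsD1 [set a; b] (star a W'); rewrite card_star.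
  have -> : [set a; b] \in star a W' by apply/imsetP; exists b.
  by move/daW' => le; apply: leq_trans le (leq_addl _ _).
apply: (mbwin_disjoint _ _ _ _ win2 win3) => [||N|].
- move=> N N' sub /andP[hN dN]; apply/andP; split; first exact: (up1 N).
  exact: (@card_star_upclosed dc) dN.
- exact: (@card_star_upclosed da).
- rewrite /= => /andP[/andP[acN /hpathP[p [up pW sp]]] dcN] daN.
  have sz : size p = #|W'| by rewrite -(card_uniqP up) (eq_card pW).
  have ac := leq_trans daN (count_adj _ _ up pW).
  have cc := leq_trans dcN (count_adj _ _ up pW).
  have ac_path : path (adj N) a [:: c] by rewrite /= andbT.
  have [||q pq sq] := @sorted_insert _ _ (adj_sym N) a [:: c] p ac_path sp.
  + by rewrite sz.
  + by rewrite sz; apply: leq_trans dW' _; rewrite leq_add2r leq_add.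
  apply/hpathP; exists q; split=> //.
    by rewrite (perm_uniq pq) /= up andbT !inE !pW negb_or eq_sym ca aW'.
  move=> x; rewrite (perm_mem pq) !inE pW !inE.
  by case: eqVneq => [->|_] //=; case: eqVneq => [->|].
rewrite disjoint_sym; apply: disjointWl (subsetDl _ _) _.
rewrite disjoints_subset; apply/subsetP=> _ /imsetP[w wW ->].
by rewrite inE; apply/negP=> /aNe; rewrite set21.
Qed.

(** * Base cases and induction *)

(** By the symmetry of the complete graph, one evaluation with opening [(0, 1)] covers every opening
    of Breaker. *)
Lemma mbwin_hpath_small k n W : 1 < n -> #|W| = n ->
  has_reply (solve k) (npaths n) (pair_seqs n) (0, 1) ->
  mbwin (hpath W) set0 (edges W).
Proof.
move=> n1 cW sol; apply/mbwinP; right; split.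
  have /card_gt1P[a [b [aW bW ab]]] : 1 < #|W| by lia.
  by apply/set0Pn; exists [set a; b]; apply/edgesP; exists a, b.
move=> _ /edgesP[a [b [ab aW bW ->]]].
(* Listing [a] and [b] first makes [(0, 1)] stand for Breaker's actual edge. *)
pose s := a :: b :: enum (W :\ a :\ b).
have us : uniq s.
  by rewrite /s /= enum_uniq !inE !mem_enum !inE (negbTE ab) !eqxx.
have sW : s =i W.
  move=> x; rewrite !inE mem_enum !inE.
  by case: (eqVneq x a) => [->|_]; [rewrite aW | case: (eqVneq x b) => [->|_]; rewrite ?bW].
have sz : size s = n by rewrite -(card_uniqP us) (eq_card sW).
pose f (e : nat * nat) := [set nth a s e.1; nth a s e.2].
have in_pairs i j : ((i, j) \in pair_seqs n) = (i < j < n).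
  apply/allpairsPdep/idP => [[j' [i' [+ + [-> ->]]]]|ij].
    by rewrite !mem_iota; lia.
  by exists j, i; rewrite !mem_iota; split=> //; lia.
have nthE i j : i < n -> j < n -> (nth a s i == nth a s j) = (i == j).
  by move=> ? ?; rewrite nth_uniq ?sz.
change [set a; b] with (f (0, 1)).
apply: (has_reply_mbwin (rec := solve k)) sol => //.
- exact: solve_mbwin.
- move=> [i j] [i' j']; rewrite !in_pairs /f /= => ij ij' /setP E.
  have := E (nth a s i); have := E (nth a s j).
  have := E (nth a s i'); have := E (nth a s j').
  rewrite !inE !nthE; try lia.
  by move=> *; congr (_, _); lia.
- move=> e; apply/edgesP/mapP => [[u [v [uv uW vW ->]]]|[[i j]]].
    have ui : index u s < n by rewrite -sz index_mem sW.
    have vi : index v s < n by rewrite -sz index_mem sW.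
    have uE : nth a s (index u s) = u by rewrite nth_index ?sW.
    have vE : nth a s (index v s) = v by rewrite nth_index ?sW.
    have [lt|gt|E] := ltngtP (index u s) (index v s).
    + by exists (index u s, index v s); rewrite ?in_pairs ?lt // /f /= uE vE.
    + by exists (index v s, index u s); rewrite ?in_pairs ?gt // /f /= uE vE setUC.
    + by move: uv; rewrite -uE -vE E eqxx.
  rewrite in_pairs => ij ->; exists (nth a s i), (nth a s j); split=> //.
  + by rewrite nthE; lia.
  + by rewrite -sW mem_nth // sz; lia.
  + by rewrite -sW mem_nth // sz; lia.
- move=> A /mapP[p]; rewrite mem_filter mem_permutations => /andP[_ pn] ->.
  move=> M' _ pM; apply/hpathP; exists (map (nth a s) p); split.
  + rewrite map_inj_in_uniq ?(perm_uniq pn) ?iota_uniq // => i j.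
    rewrite !(perm_mem pn) !mem_iota /= add0n => iN jN /eqP.
    by rewrite nthE // => /eqP.
  + move=> x; rewrite -sW; apply/mapP/idP => [[i]|xs].
      by rewrite (perm_mem pn) mem_iota => iN ->; rewrite mem_nth // sz; lia.
    exists (index x s); last by rewrite nth_index.
    by rewrite (perm_mem pn) mem_iota add0n -sz index_mem.
  case: p {pn} pM => //= x p; elim: p x => //= y p IH x pM.
  apply/andP; split; last first.
    by apply: IH => e eP; apply: pM; rewrite in_cons eP orbT.
  have := pM _ (mem_head _ _); rewrite /f /adj /=.
  by case: (leqP x y) => _ //; rewrite setUC.
by rewrite in_pairs.
Qed.

(** Five and six vertices are base cases because the steps would lead from them to four, where
    Breaker wins. *)
Lemma mbwin_hpath W : 5 <= #|W| -> mbwin (hpath W) set0 (edges W).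
Proof.
have [k] := ubnP #|W|; elim: k W => // k IH W Wk W5.
have [E|n5] := eqVneq #|W| 5.
  exact: (@mbwin_hpath_small 4 5 W isT E solve5).
have [E|n6] := eqVneq #|W| 6.
  exact: (@mbwin_hpath_small 6 6 W isT E solve6).
have [odd_W|even_W] := boolP (odd #|W|); last first.
  by apply: mbwin_hpathSS => // [|W' E]; [|apply: IH]; lia.
have /card_gt0P[v vW] : 0 < #|W| by lia.
have cW := cardsD1 v W; rewrite vW in cW.
by apply: (mbwin_hpathS vW); [|apply: IH]; lia.
Qed.

End Graph.

(** * The two directions of the equivalence *)

Lemma maker_wins_HP n s : 5 <= n -> maker_wins (HP n) s.
Proof.
move=> n5.
(* The edge between vertices 0 and 1 serves as the default element for [mbwin_maker]. *)
have e0P : #|[set Ordinal (ltnW (ltnW (ltnW (ltnW n5)))); Ordinal (ltnW (ltnW (ltnW n5)))]| == 2.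
  by rewrite cards2.
pose e0 : K_edge n := exist (fun e : {set 'I_n} => #|e| == 2) _ e0P.
apply: (mbwin_maker (F := HP n) s e0).
have W : mbwin (hpath [set: 'I_n]) set0 (edges [set: 'I_n]).
  by apply: mbwin_hpath; rewrite cardsT card_ord.
(* Through [val] the board of [HP n] becomes the set of two-element vertex sets, so that [mbwin_inj]
   applies. *)
have valT : [set val e | e in [set: K_edge n]] = edges [set: 'I_n].
  apply/setP=> e; rewrite inE subsetT; apply/imsetP/idP => [[f _ ->]|e2]; first exact: (valP f).
  by exists (exist (fun e : {set 'I_n} => #|e| == 2) e e2).
rewrite -valT -(imset0 (val : K_edge n -> _)) in W.
have := mbwin_inj val_inj W.
apply: mbwin_impl => M /hpathP[p [up pT sp]].
have sz : size p == n by rewrite -(card_uniqP up) (eq_card pT) cardsT card_ord.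
apply/exists_inP; exists (path_edges p); first by apply/imsetP; exists (Tuple sz); rewrite ?inE.
apply/subsetP=> e; rewrite inE => /hasP[[x y] /= xy /eqP eE].
suff : adj [set val e | e in M] x y.
  by rewrite /adj -eE => /imsetP[f fM /val_inj ->].
case: p xy sp {up pT sz} => //= z p; elim: p z => //= w p IH z.
rewrite in_cons => /orP[/eqP[-> ->] /andP[]|xy /andP[_]] //.
exact: IH.
Qed.

Lemma HP4_not_maker s : ~ maker_wins (HP 4) s.
Proof.
have c2 (e : K_edge 4) : #|~: val e| == 2.
  by rewrite cardsCs setCK card_ord (eqP (valP e)).
pose c e : K_edge 4 := exist (fun e : {set 'I_4} => #|e| == 2) (~: val e) (c2 e).
apply: (@pairing_breaker _ _ _ c) => [e|e|A].
- by apply: val_inj; rewrite /= setCK.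
- apply/negP=> /eqP/(congr1 val)/setP/(_ ord0); rewrite /= inE.
  by case: (_ \in _).
case/imsetP=> t; rewrite inE; case: t => [[|x [|y [|z [|w []]]]]] //= ? u ->.
move: u; rewrite !inE !negb_or andbT.
case/and3P=> /and3P[xy xz xw] /andP[yz yw] zw.
have xy2 : #|[set x; y]| == 2 by rewrite cards2 xy.
pose exy : K_edge 4 := exist (fun e : {set 'I_4} => #|e| == 2) _ xy2.
(* The witness is the first edge of the path; its partner is the last one. *)
exists exy; rewrite inE /= ?eqxx //.
suff -> : ~: [set x; y] = [set z; w] by rewrite eqxx !orbT.
apply/eqP; rewrite eq_sym eqEcard cards2 zw (eqP (c2 exy)) andbT.
apply/subsetP=> v; rewrite !inE negb_or => /orP[] /eqP ->;
  by rewrite ![_ == x]eq_sym ![_ == y]eq_sym ?xz ?xw.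
Qed.

Theorem theorem2 (n : nat) (hn : 4 <= n) :
  (maker_wins (HP n) First <-> 5 <= n) /\
  (maker_wins (HP n) Second <-> 5 <= n).
Proof.
suff H s : maker_wins (HP n) s <-> 5 <= n by split; apply: H.
split=> [win|]; last exact: maker_wins_HP.
have [E|] := eqVneq n 4; last by lia.
by case: (@HP4_not_maker s); rewrite -E.
Qed.
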